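(* Let $Q$ be a finite loop and consider the conditions: (A) $Q$ has a transversal; (B) there is no normal subloop $N$ of $Q$ such that $|N|$ is odd and $Q/N\cong\mathbb{Z}_{2^m}$ for some $m\geq 1$; (C) $A(Q)$ intersects $P(Q)$. Then (A) implies (C), and (B) holds if and only if (C) holds.
   Context: A loop is a set $Q$ with a binary operation and a neutral element $1$ such that for all $x,z\in Q$ the equations $x\cdot y_1=z$ and $y_2\cdot x=z$ have unique solutions $y_1,y_2\in Q$. Write $L_x(y)=xy$ and $R_x(y)=yx$. The inner mappings of $Q$ are $L(x,y)=L_{yx}^{-1}L_yL_x$, $R(x,y)=R_{xy}^{-1}R_yR_x$ and $T(x)=R_x^{-1}L_x$. A subloop is normal if it is invariant under all inner mappings. The associator subloop $A(Q)$ is the smallest normal subloop of $Q$ such that $Q/A(Q)$ is a group. $P(Q)$ is the set of elements of $Q$ that can be written as a product (in some order and with some association/bracketing) in which every element of $Q$ occurs as a factor precisely once. The multiplication table of $Q$ is $\{(x,y,xy):x,y\in Q\}$; in a triple $(x,y,z)$, $x$ is the row, $y$ the column and $z$ the entry. A transversal of $Q$ is a subset of its multiplication table in which each element of $Q$ appears precisely once as a row, once as a column and once as an entry. $\mathbb{Z}_{2^m}$ is the cyclic group of order $2^m$. *)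

(* Defs.v *)
From HB Require Import structures.
From mathcomp Require Import all_boot.

Set Implicit Arguments.
Unset Strict Implicit.
Unset Printing Implicit Defensive.

Local Open Scope group_scope.

HB.mixin Record UMagma_isLoop Q of UMagma Q := {
  lsolve : forall x z : Q, exists! y : Q, x * y = z;
  rsolve : forall x z : Q, exists! y : Q, y * x = z
}.

(* These structures are declared before the finite groups are loaded: HB      *)
(* rejects [FinLoop] once [FinStarMonoid] is in scope, as the two have no     *)
(* common ancestor that joins [BaseUMagma] and [Finite].                      *)
#[short(type="loopType")]
HB.structure Definition Loop := {Q of UMagma_isLoop Q & UMagma Q}.

#[short(type="finLoopType")]
HB.structure Definition FinLoop := {Q of Loop Q & Finite Q}.

From mathcomp Require Import all_fingroup all_algebra.

Section Translations.
Variable Q : finLoopType.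
Implicit Types x y z : Q.

Definition ltrans x : Q -> Q := fun y => x * y.
Definition rtrans x : Q -> Q := fun y => y * x.

Lemma ltrans_inj x : injective (ltrans x).
Proof.
move=> y z eq_yz; have [u [_ uniq_u]] := lsolve x (x * z).
by rewrite -(uniq_u y eq_yz) -(uniq_u z erefl).
Qed.

Lemma rtrans_inj x : injective (rtrans x).
Proof.
move=> y z eq_yz; have [u [_ uniq_u]] := rsolve x (z * x).
by rewrite -(uniq_u y eq_yz) -(uniq_u z erefl).
Qed.

(* [finv f] is the inverse of an injective self-map [f] of a finite type; it  *)
(* is a genuine inverse here by [ltrans_inj] and [rtrans_inj].                *)
Definition Linner x y : Q -> Q :=
  finv (ltrans (y * x)) \o ltrans y \o ltrans x.
Definition Rinner x y : Q -> Q :=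
  finv (rtrans (x * y)) \o rtrans y \o rtrans x.
Definition Tinner x : Q -> Q := finv (rtrans x) \o ltrans x.

Definition subloop (N : {set Q}) : bool :=
  [&& 1 \in N,
      [forall x in N, forall y in N, x * y \in N],
      [forall x in N, forall z in N, finv (ltrans x) z \in N]
    & [forall x in N, forall z in N, finv (rtrans x) z \in N]].

Definition normal_subloop (N : {set Q}) : bool :=
  [&& subloop N,
      [forall x, forall y, Linner x y @: N == N],
      [forall x, forall y, Rinner x y @: N == N]
    & [forall x, Tinner x @: N == N]].

(* The coset xN. *)
Definition loop_coset (N : {set Q}) x : {set Q} := ltrans x @: N.

Definition loop_cosets (N : {set Q}) : {set {set Q}} := [set loop_coset N x | x : Q].

(* On the cosets of a normal subloop this is (xN)(yN) = (xy)N: [coset_mulE].  *)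
Definition loop_setmul (A B : {set Q}) : {set Q} := [set x * y | x in A, y in B].

End Translations.

Record normalSubloop (Q : finLoopType) := NormalSubloop {
  normalSubloop_set :> {set Q};
  normalSubloopP : normal_subloop normalSubloop_set
}.

HB.instance Definition _ (Q : finLoopType) :=
  [isSub for @normalSubloop_set Q].
HB.instance Definition _ (Q : finLoopType) :=
  [Finite of normalSubloop Q by <:].

Section CosetTheory.
Variables (Q : finLoopType) (N : normalSubloop Q).
Implicit Types x y z : Q.

Lemma nsub1 : 1 \in (N : {set Q}).
Proof. by case: N => M /= /and4P[/and4P[]]. Qed.

Lemma nsubM x y : x \in (N : {set Q}) -> y \in (N : {set Q}) ->
  x * y \in (N : {set Q}).
Proof.
case: N => M /= /and4P[/and4P[_ /forall_inP MM _ _] _ _ _] Mx My.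
by have /forall_inP := MM x Mx; apply.
Qed.

Lemma coset1_id n : n \in (N : {set Q}) -> loop_coset N n = N.
Proof.
move=> Nn; apply/eqP; rewrite eqEcard card_imset ?leqnn ?andbT; last first.
  exact: ltrans_inj.
by apply/subsetP=> _ /imsetP[m Nm ->]; apply: nsubM.
Qed.

Lemma ltrans_coset y x : ltrans y @: loop_coset N x = loop_coset N (y * x).
Proof.
case: N => M /= /and4P[_ /forallP/(_ x)/forallP/(_ y)/eqP eqM _ _].
rewrite /loop_coset -{2}eqM -!imset_comp; apply: eq_imset => z /=.
by rewrite (f_finv (@ltrans_inj _ _)).
Qed.

Lemma loop_rcosetE x : rtrans x @: (N : {set Q}) = loop_coset N x.
Proof.
case: N => M /= /and4P[_ _ _ /forallP/(_ x)/eqP eqM].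
rewrite /loop_coset -{1}eqM -!imset_comp; apply: eq_imset => z /=.
by rewrite (f_finv (@rtrans_inj _ _)).
Qed.

Lemma rtrans_coset y x : rtrans y @: loop_coset N x = loop_coset N (x * y).
Proof.
rewrite -!loop_rcosetE.
case: N => M /= /and4P[_ _ /forallP/(_ x)/forallP/(_ y)/eqP eqM _].
rewrite -{2}eqM -!imset_comp; apply: eq_imset => z /=.
by rewrite (f_finv (@rtrans_inj _ _)).
Qed.

Lemma mem_loop_coset x : x \in loop_coset N x.
Proof. by apply/imsetP; exists 1; rewrite ?nsub1 // /ltrans mulg1. Qed.

Lemma coset_eqP x y : reflect (loop_coset N x = loop_coset N y)
                              (x \in loop_coset N y).
Proof.
apply: (iffP idP) => [/imsetP[n Nn ->]|<-]; last exact: mem_loop_coset.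
by rewrite -ltrans_coset coset1_id.
Qed.

Lemma coset_mulE x y :
  loop_setmul (loop_coset N x) (loop_coset N y) = loop_coset N (x * y).
Proof.
apply/setP=> z; apply/imset2P/idP => [[u v xu yv ->]|].
  apply/coset_eqP; rewrite -[RHS]ltrans_coset -(coset_eqP v y yv) ltrans_coset.
  by rewrite -[RHS]rtrans_coset -(coset_eqP u x xu) rtrans_coset.
rewrite -ltrans_coset => /imsetP[v yv ->].
by exists x v; rewrite ?mem_loop_coset.
Qed.

End CosetTheory.

Definition quotient_loop (Q : finLoopType) (N : normalSubloop Q) : Type :=
  {A : {set Q} | A \in loop_cosets N}.

Section Quotient.
Variables (Q : finLoopType) (N : normalSubloop Q).

HB.instance Definition _ := Finite.on (quotient_loop N).

Lemma loop_coset_in x : loop_coset N x \in loop_cosets N.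
Proof. exact: imset_f. Qed.

Definition to_quotient (x : Q) : quotient_loop N := Sub (loop_coset N x) (loop_coset_in x).

Lemma to_quotientP (A : quotient_loop N) : exists x, A = to_quotient x.
Proof.
by case: A => A cA; have /imsetP[x _ defA] := cA; exists x; apply: val_inj.
Qed.

Lemma quotient_mul_subproof (A B : quotient_loop N) :
  loop_setmul (val A) (val B) \in loop_cosets N.
Proof.
have [x ->] := to_quotientP A; have [y ->] := to_quotientP B.
by rewrite /= coset_mulE loop_coset_in.
Qed.

Definition quotient_mul (A B : quotient_loop N) : quotient_loop N :=
  Sub (loop_setmul (val A) (val B)) (quotient_mul_subproof A B).

HB.instance Definition _ := hasMul.Build (quotient_loop N) quotient_mul.

Lemma to_quotientM : {morph to_quotient : x y / x * y >-> x * y}.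
Proof. by move=> x y; apply: val_inj; rewrite /= coset_mulE. Qed.

Lemma quotient_mul1g : left_id (to_quotient 1) (fun A B : quotient_loop N => A * B).
Proof. by move=> A; have [x ->] := to_quotientP A; rewrite -to_quotientM mul1g. Qed.

Lemma quotient_mulg1 : right_id (to_quotient 1) (fun A B : quotient_loop N => A * B).
Proof. by move=> A; have [x ->] := to_quotientP A; rewrite -to_quotientM mulg1. Qed.

HB.instance Definition _ :=
  Magma_isUMagma.Build (quotient_loop N) quotient_mul1g quotient_mulg1.

Lemma quotient_solve (f : quotient_loop N -> quotient_loop N) :
  (forall C, exists A, f A = C) -> forall C, exists! A, f A = C.
Proof.
move=> f_surj.
have /fin_all_exists[g gK] := f_surj.
have [h hK gh] : bijective g by apply: injF_bij; apply: can_inj gK.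
move=> C; exists (g C); split=> // A fA.
by rewrite -fA -[A in f A]gh gK gh.
Qed.

Lemma quotient_lsolve (A C : quotient_loop N) : exists! B, A * B = C.
Proof.
apply: (quotient_solve (f := fun B => A * B)) => {}C.
have [x ->] := to_quotientP A; have [z ->] := to_quotientP C.
have [y [<- _]] := lsolve x z.
by exists (to_quotient y); rewrite -to_quotientM.
Qed.

Lemma quotient_rsolve (A C : quotient_loop N) : exists! B, B * A = C.
Proof.
apply: (quotient_solve (f := fun B => B * A)) => {}C.
have [x ->] := to_quotientP A; have [z ->] := to_quotientP C.
have [y [<- _]] := rsolve x z.
by exists (to_quotient y); rewrite -to_quotientM.
Qed.

HB.instance Definition _ :=
  UMagma_isLoop.Build (quotient_loop N) quotient_lsolve quotient_rsolve.

End Quotient.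

(* A group is an associative loop. *)
Definition is_group (Q : finLoopType) : bool :=
  [forall x : Q, forall y : Q, forall z : Q, x * (y * z) == x * y * z].

(* The smallest normal subloop with a group quotient, as shown by             *)
(* [associator_subloop_normal], [associator_subloop_quotient] and             *)
(* [associator_subloop_min].                                                  *)
Definition associator_subloop (Q : finLoopType) : {set Q} :=
  \bigcap_(N : normalSubloop Q | is_group (quotient_loop N)) N.

Section Associator.
Variable Q : finLoopType.

Lemma is_group_quotientP (N : normalSubloop Q) :
  reflect (forall x y z, x * (y * z) \in loop_coset N (x * y * z))
          (is_group (quotient_loop N)).
Proof.
apply: (iffP forallP) => [asN x y z|asN A].
  have /forallP/(_ (to_quotient N y))/forallP/(_ (to_quotient N z)) :=
    asN (to_quotient N x).
  by rewrite -!to_quotientM => /eqP/(congr1 val)/= /coset_eqP.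
apply/forallP=> B; apply/forallP=> C.
have [x ->] := to_quotientP A; have [y ->] := to_quotientP B.
have [z ->] := to_quotientP C; rewrite -!to_quotientM.
by apply/eqP/val_inj/coset_eqP.
Qed.

Lemma sub_invariant_eq (f : Q -> Q) (N : {set Q}) :
  injective f -> (forall x, x \in N -> f x \in N) -> f @: N == N.
Proof.
move=> f_inj fN; rewrite eqEcard card_imset // leqnn andbT.
by apply/subsetP=> _ /imsetP[x Nx ->]; apply: fN.
Qed.

Lemma associator_subloop_normal : normal_subloop (associator_subloop Q).
Proof.
have in_cap f : (forall N : normalSubloop Q, f @: (N : {set Q}) == N) ->
    forall x, x \in associator_subloop Q -> f x \in associator_subloop Q.
  move=> fN x /bigcapP Ax; apply/bigcapP=> N gN.
  by rewrite -(eqP (fN N)) imset_f ?Ax.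
have Linj x y : injective (@Linner Q x y).
  apply: inj_comp; last exact: ltrans_inj.
  by apply: inj_comp; [apply: finv_inj|]; apply: ltrans_inj.
have Rinj x y : injective (@Rinner Q x y).
  apply: inj_comp; last exact: rtrans_inj.
  by apply: inj_comp; [apply: finv_inj|]; apply: rtrans_inj.
have Tinj x : injective (@Tinner Q x).
  by apply: inj_comp; [apply: finv_inj; apply: rtrans_inj|apply: ltrans_inj].
apply/and4P; split; last 3 first.
- apply/forallP=> x; apply/forallP=> y; apply: sub_invariant_eq => //.
  apply: in_cap => N; case: N => M /= /and4P[_ /forallP/(_ x)/forallP/(_ y)].
  by [].
- apply/forallP=> x; apply/forallP=> y; apply: sub_invariant_eq => //.
  apply: in_cap => N; case: N => M /= /and4P[_ _ /forallP/(_ x)/forallP/(_ y)].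
  by [].
- apply/forallP=> x; apply: sub_invariant_eq => //.
  by apply: in_cap => N; case: N => M /= /and4P[_ _ _ /forallP/(_ x)].
apply/and4P; split.
- by apply/bigcapP=> N _; apply: nsub1.
- apply/forall_inP=> x /bigcapP Ax; apply/forall_inP=> y /bigcapP Ay.
  by apply/bigcapP=> N gN; rewrite nsubM ?Ax ?Ay.
- apply/forall_inP=> x /bigcapP Ax; apply/forall_inP=> y /bigcapP Ay.
  apply/bigcapP=> N gN; move: (Ax N gN) (Ay N gN).
  case: (N) => M /= /and4P[/and4P[_ _ /forall_inP MM _] _ _ _] Mx My.
  by have /forall_inP := MM x Mx; apply.
apply/forall_inP=> x /bigcapP Ax; apply/forall_inP=> y /bigcapP Ay.
apply/bigcapP=> N gN; move: (Ax N gN) (Ay N gN).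
case: (N) => M /= /and4P[/and4P[_ _ _ /forall_inP MM] _ _ _] Mx My.
by have /forall_inP := MM x Mx; apply.
Qed.

Lemma associator_subloop_quotient :
  is_group (quotient_loop (NormalSubloop associator_subloop_normal)).
Proof.
apply/is_group_quotientP => x y z /=.
have [n [defn _]] := lsolve (x * y * z) (x * (y * z)).
apply/imsetP; exists n => //; apply/bigcapP=> N /is_group_quotientP/(_ x y z).
by case/imsetP=> m Nm; rewrite -defn => /ltrans_inj ->.
Qed.

Lemma associator_subloop_min (N : normalSubloop Q) :
  is_group (quotient_loop N) -> associator_subloop Q \subset N.
Proof. by move=> gN; apply: bigcap_inf. Qed.

End Associator.

Inductive product_tree (T : Type) : Type :=
| Factor of T
| Product of product_tree T & product_tree T.

Fixpoint factors (T : Type) (t : product_tree T) : seq T :=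
  match t with
  | Factor x => [:: x]
  | Product t1 t2 => factors t1 ++ factors t2
  end.

Fixpoint product_value (Q : magmaType) (t : product_tree Q) : Q :=
  match t with
  | Factor x => x
  | Product t1 t2 => product_value t1 * product_value t2
  end.

(* The set P(Q), as a predicate. *)
Definition full_product (Q : finLoopType) (q : Q) : Prop :=
  exists t : product_tree Q,
    (forall x : Q, count_mem x (factors t) = 1%N) /\ product_value t = q.

Section Transversals.
Variable Q : finLoopType.

Definition mult_table : {set Q * Q * Q} := [set (x, y, x * y) | x : Q, y : Q].

Definition loop_transversal (S : {set Q * Q * Q}) : Prop :=
  [/\ S \subset mult_table,
      forall x : Q, #|[set t in S | t.1.1 == x]| = 1%N,
      forall y : Q, #|[set t in S | t.1.2 == y]| = 1%N
    & forall z : Q, #|[set t in S | t.2 == z]| = 1%N].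

End Transversals.

(* Pitfall: ['Z_n] is Z/nZ only for [1 < n]. *)
Definition isom_Zn (Q : finLoopType) (n : nat) : Prop :=
  exists f : Q -> 'Z_n, bijective f /\ {morph f : x y / x * y >-> (x + y)%R}.

Definition conditionA (Q : finLoopType) : Prop :=
  exists S : {set Q * Q * Q}, loop_transversal S.

Definition conditionB (Q : finLoopType) : Prop :=
  ~ exists (N : normalSubloop Q) (m : nat),
      [/\ odd #|N|, (1 <= m)%N & isom_Zn (quotient_loop N) (2 ^ m)%N].

Definition conditionC (Q : finLoopType) : Prop :=
  exists q : Q, q \in associator_subloop Q /\ full_product q.

(* Main.v *)
Require Import Defs.
From mathcomp Require Import all_boot all_fingroup all_algebra.
From mathcomp Require Import all_solvable.

(** Summing over Q with values in a quotient Z_(2^m) by a normal subloop of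
    odd order gives an odd multiple of 2^(m-1), which is nonzero; a transversal
    or a full product in A(Q) would make this sum 0. Hence (A) and (C) both
    imply (B).

    For the converse let G = Q/A(Q) and k = |A(Q)|. Bracketing is irrelevant in
    G, so (C) asks for a word with product 1 in which every element of G occurs
    k times. For even k, use the factors g g^-1. For odd k it suffices to order
    G itself with product 1, in the spirit of Vaughan-Lee and Wanless. A cyclic
    nontrivial Sylow 2-subgroup yields by transfer a quotient that contradicts
    (B); if G has odd order, pair inverses. Otherwise take an involution v. For
    an involution x not commuting with v, the double coset
    {x, vx, xv, vxv} has product (vx) x (xv) (vxv) = 1. The rest splits into
    pairs {u, u^-1} and {u, uv} with product 1 or v, and the parity of the
    number of factors v is controlled using either a commutator [x, y] = v with
    x, y centralising v, or a second involution commuting with v. A noncyclic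
    2-group provides one of the two. *)

Set Implicit Arguments.
Unset Strict Implicit.
Unset Printing Implicit Defensive.

Local Open Scope group_scope.

(** * Orderings of a finite subset of a group with prescribed product *)

Section Arrangements.
Variable gT : finGroupType.
Implicit Types (X Y : {set gT}) (G H : {group gT}) (u v w x y g h : gT).

Definition arranges X g : Prop :=
  exists s : seq gT, [/\ uniq s, s =i X & \prod_(x <- s) x = g].

Lemma arranges0 : arranges set0 1.
Proof. by exists [::]; split=> // [x|]; rewrite ?inE ?big_nil. Qed.

Lemma arrangesU X Y g h :
  [disjoint X & Y] -> arranges X g -> arranges Y h -> arranges (X :|: Y) (g * h).
Proof.
move=> dXY [s [us sX <-]] [t [ut tY <-]]; exists (s ++ t); split.
- rewrite cat_uniq us ut andbT /=; apply/hasPn=> x; rewrite tY sX => Yx.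
  by apply/negP=> Xx; rewrite (disjointFr dXY Xx) in Yx.
- by move=> x; rewrite mem_cat inE sX tY.
- by rewrite big_cat.
Qed.

(** The blocks [B x] partition [X], and their orderings are concatenated one block at a time. The
    order of the blocks is not controlled, so only membership of the product in [H] is retained. *)
Lemma arranges_blocks (B : gT -> {set gT}) X H :
  {in X, forall x, [/\ x \in B x, B x \subset X,
                       {in B x, forall y, B y = B x}
                     & exists2 h, h \in H & arranges (B x) h]} ->
  exists2 h, h \in H & arranges X h.
Proof.
have [n] := ubnP #|X|; elim: n X => // n IHn X leXn BX.
have [->|[x Xx]] := set_0Vmem X; first by exists 1; [|exact: arranges0].
have [Bxx sBX eqB [h Hh arrB]] := BX x Xx.
have [||k Hk arrD] := IHn (X :\: B x).
- rewrite -ltnS (leq_trans _ leXn) // ltnS; apply/proper_card/properP.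
  by split; [exact: subsetDl|exists x; rewrite // inE Bxx].
- move=> y /setDP[Xy nBxy]; have [Byy sByX eqBy arrBy] := BX y Xy; split=> //.
  apply/subsetP=> z Byz; rewrite inE (subsetP sByX) // andbT.
  by apply: contra nBxy => Bxz; rewrite -(eqB z Bxz) (eqBy z Byz).
exists (h * k); first exact: groupM.
rewrite -(setID X (B x)) (setIidPr sBX); apply: arrangesU => //.
by rewrite -setI_eq0 setIDA setDIl setDv set0I.
Qed.

Lemma arranges_blocks1 (B : gT -> {set gT}) X :
  {in X, forall x, [/\ x \in B x, B x \subset X,
                       {in B x, forall y, B y = B x} & arranges (B x) 1]} ->
  arranges X 1.
Proof.
move=> BX; have [x Xx|h] := @arranges_blocks B X 1%G.
  by have [? ? ? ?] := BX x Xx; split=> //; exists 1.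
by rewrite inE => /eqP ->.
Qed.

Lemma arranges2 x y : x != y -> arranges [set x; y] (x * y).
Proof.
move=> nxy; exists [:: x; y]; split; rewrite ?big_cons ?big_nil ?mulg1 //=.
  by rewrite inE nxy.
by move=> z; rewrite !inE.
Qed.

Lemma arranges_odd G : odd #|G| -> arranges G 1.
Proof.
move=> oddG; have inv2 x : x \in G -> x^-1 = x -> x = 1.
  move=> Gx eqx; apply/eqP; rewrite -order_eq1 -dvdn1.
  have /eqP <- : coprime #|G| 2 by rewrite coprimen2.
  rewrite dvdn_gcd order_dvdG // order_dvdn expgS expg1 -{2}eqx.
  by rewrite mulgV eqxx.
rewrite -(setD1K (group1 G)).
have /arrangesU arrG : [disjoint 1%G & G :\ (1 : gT)].
  by rewrite disjoint_sym disjoints_subset subsetDr.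
have {}arrG := arrG 1 1; rewrite mulg1 in arrG; apply: arrG.
  by exists [:: 1]; split; rewrite ?big_seq1 // => x; rewrite !inE.
apply: (@arranges_blocks1 (fun x => [set x; x^-1])) => x /setD1P[nx1 Gx].
split; first by rewrite !inE eqxx.
- by rewrite subUset !sub1set !inE groupV Gx nx1 invg_eq1 nx1.
- by move=> y; rewrite !inE => /orP[]/eqP -> //; rewrite invgK setUC.
have := @arranges2 x x^-1; rewrite mulgV; apply.
by apply: contra_neq nx1 => /esym/(inv2 x Gx).
Qed.

End Arrangements.

(** * Arranging a group that contains an involution *)

Section Involution.
Variables (gT : finGroupType) (G : {group gT}) (v : gT).
Hypotheses (Gv : v \in G) (nt_v : v != 1) (vv : v * v = 1).
Implicit Types (u w x y z h : gT).

Let vK u : v * (v * u) = u.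
Proof. by rewrite mulgA vv mul1g. Qed.
Let Kv u : u * v * v = u.
Proof. by rewrite -mulgA vv mulg1. Qed.
Let vV : v^-1 = v.
Proof. by apply: (mulgI v); rewrite mulgV vv. Qed.

(** For [u] not commuting with [v], the second condition says that the double coset of [u] modulo
    [<[v]>] contains an involution. *)
Let P u := (v * u != u * v) && ((u * u == 1) || (v * u * (v * u) == 1)).

Let P_mull u : P (v * u) = P u.
Proof.
rewrite /P vK orbC; congr (~~ _ && _); apply/eqP/eqP => e.
  by rewrite {2}e Kv.
by rewrite e Kv.
Qed.

(** [x * y] and [y * x] are conjugate. *)
Let square_swap x y : (x * y * (x * y) == 1) = (y * x * (y * x) == 1).
Proof.
wlog suff : x y / x * y * (x * y) = 1 -> y * x * (y * x) = 1.
  by move=> sw; apply/eqP/eqP; apply: sw.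
by move=> e; apply: (mulgI x); rewrite mulg1 -[RHS]mul1g -e !mulgA.
Qed.

Let P_mulr u : P (u * v) = P u.
Proof.
rewrite /P Kv (square_swap v (u * v)) Kv orbC (square_swap u v).
congr (~~ _ && (_ || _)); apply/eqP/eqP => e.
  by rewrite -{2}e -!mulgA vv mulg1.
by rewrite mulgA e Kv.
Qed.

Let P_inv u : P u^-1 = P u.
Proof.
have eqV x y : (x^-1 == y^-1) = (x == y) by apply: (inj_eq invg_inj).
rewrite /P -(eqV (v * u^-1)) -(eqV (u^-1 * u^-1)) -(eqV (v * u^-1 * _)).
by rewrite !invMg !invgK vV invg1 eq_sym (square_swap u v).
Qed.

Let P_comm u : v * u = u * v -> ~~ P u.
Proof. by move=> cvu; rewrite /P cvu eqxx. Qed.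

Let comm_P u : ~~ P u -> u * u = 1 -> v * u = u * v.
Proof. by move=> + uu; rewrite /P uu eqxx andbT negbK => /eqP. Qed.

Let noncommuting_block_arranged x : x * x = 1 -> v * x != x * v ->
  arranges [set x; v * x; x * v; v * x * v] 1.
Proof.
move=> xx ncvx; exists [:: v * x; x; x * v; v * x * v]; split.
- have nvx : v * x != x by rewrite -{2}(mul1g x) (inj_eq (mulIg x)).
  have nxv : x * v != x by rewrite -{2}(mulg1 x) (inj_eq (mulgI x)).
  have nxvx : v * x * v != x.
    by apply: contra_neq ncvx => e; rewrite -{2}e Kv.
  rewrite /= !inE !negb_or nvx ncvx ![x == _]eq_sym nxv nxvx /= !andbT.
  by rewrite eq_sym -{2}(mulg1 (v * x)) (inj_eq (mulgI _)) nt_v -mulgA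
             -{1}(mul1g (x * v)) (inj_eq (mulIg _)) eq_sym nt_v.
- by move=> z; rewrite !inE; do 4!case: (z == _).
by rewrite !big_cons big_nil mulg1 !mulgA -(mulgA v x x) xx mulg1 Kv -(mulgA v x) xx mulg1.
Qed.

Let noncommuting_arranged : arranges [set u in G | P u] 1.
Proof.
pose B x := [set x; v * x; x * v; v * x * v].
have Bl x : B (v * x) = B x.
  by rewrite /B vK; apply/setP=> z; rewrite !inE; do 4!case: (z == _).
have Br x : B (x * v) = B x.
  by rewrite /B mulgA !Kv; apply/setP=> z; rewrite !inE; do 4!case: (z == _).
apply: (@arranges_blocks1 _ B) => x; rewrite inE => /andP[Gx Px]; split.
- by rewrite !inE eqxx.
- by rewrite !subUset !sub1set !inE !(P_mulr, P_mull) Px Gx !groupM.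
- by move=> y; rewrite !inE -!orbA => /or4P[]/eqP->; rewrite ?Br ?Bl.
have /andP[ncvx /orP[]/eqP xx] := Px; first exact: noncommuting_block_arranged.
(* Here [v * x] is the involution, and it has the same block as [x]. *)
rewrite -Bl; apply: noncommuting_block_arranged => //.
by have := Px; rewrite -P_mull => /andP[].
Qed.

(** Once these inverse pairs and the elements satisfying [P] are removed, only elements of square 1
    that commute with [v] remain, by [comm_P]. *)
Let noninvolutions_arranged :
  arranges [set u in G | ~~ P u & u * u != 1] 1.
Proof.
apply: (@arranges_blocks1 _ (fun x => [set x; x^-1])) => x; rewrite inE.
case/and3P=> Gx nPx nxx; have nxV : x^-1 != x.
  by apply: contra_neq nxx => e; rewrite -{1}e mulVg.
split; first by rewrite !inE eqxx.
- rewrite subUset !sub1set !inE groupV Gx P_inv nPx nxx /=.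
  by rewrite -invMg invg_eq1.
- by move=> y; rewrite !inE => /orP[]/eqP -> //; rewrite invgK setUC.
by have := @arranges2 _ x x^-1; rewrite mulgV eq_sym; apply.
Qed.

(* Outside the double cosets of [<[v]>] treated above, [G] splits into pairs  *)
(* [{u, p u}] of product [1] or [v]. Ordering the pairs of [x] and [y] as     *)
(* [x, y, p x, p y] instead of [x, p x, y, p y] multiplies their product by   *)
(* [v], so the total product can be adjusted to [1].                          *)
Lemma arranges_involution_commutator x y :
    x \in G -> y \in G -> v * x = x * v -> v * y = y * v ->
    x * y = v * (y * x) ->
  arranges G 1.
Proof.
move=> Gx Gy cvx cvy xyE.
have ncxy : x * y != y * x.
  rewrite xyE; apply: contra_neq nt_v => e.
  by apply: (mulIg (y * x)); rewrite mul1g.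
(* When [u] is its own inverse, [u^-1] is replaced by [u^-1 * v], so that [p] has no fixed point;
   [e u] is the product of the pair. *)
pose e u := if u * u == 1 then v else 1; pose p u : gT := (u^-1 : gT) * e u.
have e_comm u z : v * z = z * v -> e u * z = z * e u.
  by move=> cvz; rewrite /e; case: ifP; rewrite ?mul1g ?mulg1.
have eu_comm u : ~~ P u -> e u * u = u * e u.
  by rewrite /e; case: ifP => [/eqP uu /comm_P->//|]; rewrite mul1g mulg1.
have ev u : e u * e u = 1 by rewrite /e; case: ifP; rewrite ?mulg1.
have pE u : u * p u = e u by rewrite /p mulKVg.
have nPp u : ~~ P u -> ~~ P (p u).
  by rewrite /p /e; case: ifP; rewrite ?mulg1 ?P_mulr P_inv.
have pp u : ~~ P u -> p u * p u = (u * u)^-1.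
  move=> nPu; have := eu_comm u nPu => /(congr1 (fun z => u^-1 * z * u^-1)).
  rewrite mulKg -!mulgA mulgV mulg1 => eV.
  by rewrite /p [e u * _]mulgA -eV -!mulgA ev mulg1 invMg.
have ep u : ~~ P u -> e (p u) = e u by move=> nPu; rewrite /e pp // invg_eq1.
have pK u : ~~ P u -> p (p u) = u.
  move=> nPu; rewrite {1}/p ep // /p invMg invgK -mulgA -eu_comm // mulKg //.
have np u : u != p u.
  apply/eqP=> eu; have := pE u; rewrite -eu /e; case: ifP => [/eqP->|/eqP//].
  by move/esym/eqP; rewrite (negPf nt_v).
have pG u : u \in G -> p u \in G.
  by move=> Gu; rewrite /p /e groupM ?groupV //; case: ifP.
have Bp u : ~~ P u -> [set p u; p (p u)] = [set u; p u].
  by move=> nPu; rewrite pK // setUC.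
have e2 u : e u \in <[v]> by rewrite /e; case: ifP; rewrite ?cycle_id ?group1.
have nPx := P_comm cvx; have nPy := P_comm cvy.
pose D := [set x; p x] :|: [set y; p y].
pose W := [set u in G | ~~ P u] :\: D.
have [u|h] := @arranges_blocks _ (fun u => [set u; p u]) W <[v]>%G.
  rewrite !inE -!orbA !negb_or => /andP[/and4P[nux nupx nuy nupy] /andP[Gu nPu]].
  have p_eq z : ~~ P z -> (p u == z) = (u == p z).
    by move=> nPz; apply/eqP/eqP => [<-|->]; rewrite pK.
  split; first by rewrite eqxx.
  - rewrite subUset !sub1set !inE nPu Gu nPp // pG // -!orbA !negb_or.
    by rewrite nux nupx nuy nupy !p_eq ?nPp // !pK // nux nupx nuy nupy.
  - by move=> z; rewrite !inE => /orP[]/eqP -> //; apply: Bp.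
  by exists (e u) => //; rewrite -pE; apply: arranges2.
have ov : #[v] = 2%N by apply: nt_prime_order.
rewrite /= cycle2g // => h2 arrW.
(* [y] does not commute with [x], so it is neither [x] nor [p x]. *)
have uniqD : uniq [:: x; p x; y; p y].
  have npxy : p x != y.
    by apply: contra_neq ncxy => <-; rewrite pE /p -mulgA eu_comm // mulKg.
  have nxy : x != y by apply: contra_neq ncxy => ->.
  rewrite /= !inE !negb_or np nxy npxy np /= !andbT; apply/andP; split.
    by apply: contra_neq npxy => ->; rewrite pK.
  by apply: contra_neq nxy => /(congr1 p); rewrite !pK.
have DE : [:: x; p x; y; p y] =i D by move=> z; rewrite !inE -!orbA.
have arr1 : arranges D (e x * e y).
  exists [:: x; p x; y; p y]; split=> //.
  by rewrite !big_cons big_nil mulg1 pE mulgA pE.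
have arr2 : arranges D (v * (e x * e y)).
  exists [:: x; y; p x; p y]; split; last 1 first.
  - rewrite !big_cons big_nil mulg1 mulgA xyE /p -!mulgA; congr (v * _).
    by rewrite mulKVg mulgA -(e_comm x y cvy) -mulgA mulKVg.
  - move: uniqD; rewrite /= !inE !negb_or ![p x == _]eq_sym.
    by case/and4P=> /and3P[-> -> ->] /andP[-> ->] -> _.
  - by move=> z; rewrite -DE !inE; do 4!case: (z == _).
(* The products [e x * e y] and [v * (e x * e y)] exhaust {1, v}, so [D] can be given the same
   product [h] as [W], and [h * h = 1]. *)
have {arr1 arr2} arrD : arranges D h.
  have [e1|e1] : e x * e y = h \/ v * (e x * e y) = h.
    move: h2; rewrite !inE /e; case: ifP => _; case: ifP => _ /orP[]/eqP->;
      rewrite ?vv ?mul1g ?mulg1 ?vv; by [left|right].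
    by rewrite -e1.
  by rewrite -e1.
have hh : h * h = 1 by move: h2; rewrite !inE => /orP[]/eqP->; rewrite ?mul1g.
have dD : [disjoint D & W] by rewrite -setI_eq0 setIDA setIC -setIDA setDv setI0.
have /arrangesU/(_ noncommuting_arranged) := arrangesU dD arrD arrW.
rewrite hh mulg1 => arrG.
have UE : D :|: W = [set u in G | ~~ P u].
  rewrite /W setDE setUIr setUCr setIT; apply/setUidPr.
  by rewrite !subUset !sub1set !inE ?nPp // nPx nPy !pG ?Gx ?Gy.
have GE : [set u in G | ~~ P u] :|: [set u in G | P u] = G.
  by apply/setP=> u; rewrite !inE; case: (u \in G); case: (P u).
rewrite UE GE in arrG; apply: arrG.
rewrite -setI_eq0; apply/eqP/setP=> u; rewrite !inE.
by case: (P u); rewrite ?andbF.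
Qed.

(* If no commutator of elements of the centraliser of [v] equals [v], then    *)
(* the involution [f] of the proof merges the pairs [{u, v * u}] of           *)
(* involutions centralising [v] two by two, and each merged block has product *)
(* [v * v].                                                                   *)
Lemma arranges_commuting_involutions w :
  w \in G -> w != 1 -> w != v -> w * w = 1 -> v * w = w * v -> arranges G 1.
Proof.
move=> Gw nt_w nwv ww cvw.
have wK u : w * (w * u) = u by rewrite mulgA ww mul1g.
have Kw u : u * w * w = u by rewrite -mulgA ww mulg1.
have [/exists_inP[x /andP[Gx /eqP cvx]
     /exists_inP[y /andP[Gy /eqP cvy] /eqP xyE]]|ncomm] :=
  boolP [exists (x | (x \in G) && (v * x == x * v)),
           exists (y | (y \in G) && (v * y == y * v)), x * y == v * (y * x)].
  exact: arranges_involution_commutator xyE.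
have {}ncomm x : x \in G -> v * x = x * v -> w * x != v * (x * w).
  move=> Gx cvx; apply: contraNneq ncomm => e.
  apply/exists_inP; exists w; first by rewrite Gw cvw eqxx.
  by apply/exists_inP; exists x; rewrite ?Gx ?cvx ?e ?eqxx.
pose X := [set u in G | (v * u == u * v) && (u * u == 1)].
(* For [u] in [X] both branches give an element of square 1 other than [u] and [v * u]: in the
   first, [w] is neither 1 nor [v]; in the second, [w] and [u] do not commute, and
   [w * u * w = v * u] is excluded by [ncomm]. *)
pose f u := if w * u == u * w then w * u else w * u * w.
pose B u := [set u; v * u; f u; v * f u].
have cmm u z : v * u = u * v -> v * z = z * v -> v * (u * z) = u * z * v.
  by move=> cu cz; rewrite mulgA cu -mulgA cz mulgA.
have fP u : u \in G -> v * u = u * v -> u * u = 1 ->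
    [/\ f u \in G, v * f u = f u * v, f u * f u = 1, f (f u) = u
      & f (v * u) = v * f u /\ (u != f u) && (v * u != f u)].
  move=> Gu cvu uu.
  have vwuE : (w * (v * u) == v * u * w) = (w * u == u * w).
    by rewrite mulgA -cvw -!mulgA (inj_eq (mulgI v)).
  rewrite /f vwuE; case: ifP => [/eqP cwu|/eqP ncwu].
    have -> : w * u * w = u by rewrite cwu Kw.
    rewrite !wK eqxx; split=> //.
    - exact: groupM.
    - exact: cmm.
    - by rewrite {2}cwu mulgA -(mulgA w u u) uu mulg1.
    split; first by rewrite mulgA -cvw mulgA.
    rewrite -{1}(mul1g u) !(inj_eq (mulIg u)) eq_sym nt_w /=.
    by rewrite eq_sym.
  have -> : (w * (w * u * w) == w * u * w * w) = false.
    by rewrite Kw -mulgA wK eq_sym; apply/eqP.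
  split; first by rewrite !groupM.
  - by rewrite !cmm.
  - by rewrite !mulgA Kw -(mulgA w u u) uu mulg1.
  - by rewrite !mulgA ww mul1g Kw.
  split; first by rewrite !mulgA cvw.
  apply/andP; split; apply/eqP => e.
    by case: ncwu; rewrite {2}e Kw.
  by have /eqP[] := ncomm u Gu cvu; rewrite mulgA e Kw.
have arrX : arranges X 1.
  apply: (@arranges_blocks1 _ B) => u; rewrite inE.
  case/and3P=> Gu /eqP cvu /eqP uu.
  have [Gf cvf ff fK [fv /andP[nuf nvuf]]] := fP u Gu cvu uu.
  have v2 z : v * z = z * v -> z * z = 1 -> v * z * (v * z) = 1.
    by move=> cz zz; rewrite {1}cz -mulgA vK.
  have Bv z : z \in G -> v * z = z * v -> z * z = 1 -> B (v * z) = B z.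
    move=> Gz cz zz; have [_ _ _ _ [fvz _]] := fP z Gz cz zz.
    rewrite /B fvz !vK.
    by apply/setP=> t; rewrite !inE; do 4!case: (t == _).
  have Bf : B (f u) = B u.
    by rewrite /B fK; apply/setP=> t; rewrite !inE; do 4!case: (t == _).
  split; first by rewrite !inE eqxx.
  - rewrite !subUset !sub1set !inE Gu Gf !groupM // uu ff cvu cvf !eqxx /=.
    by rewrite -!cvu -!cvf !vK !v2 // -!mulgA -cvu -cvf !vK !eqxx.
  - move=> z; rewrite !inE -!orbA => /or4P[]/eqP-> //.
    + exact: Bv.
    + by rewrite Bv.
  exists [:: u; v * u; f u; v * f u]; split.
  - have nv z : z != v * z by rewrite -{1}(mul1g z) (inj_eq (mulIg z)) eq_sym.
    have uvf : u != v * f u by rewrite -(inj_eq (mulgI v)) vK.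
    rewrite /= !inE !negb_or !nv nuf uvf nvuf (inj_eq (mulgI v)) nuf //.
  - by move=> z; rewrite !inE -!orbA.
  by rewrite !big_cons big_nil mulg1 cvu cvf !mulgA uu mul1g -(mulgA v) ff mulg1.
have PX u : u * u == 1 -> P u = ~~ (v * u == u * v).
  by rewrite /P => ->; rewrite andbT.
have dX : [disjoint X & [set u in G | ~~ P u & u * u != 1]].
  rewrite -setI_eq0; apply/eqP/setP=> u; rewrite !inE.
  by case: (u * u == 1); rewrite ?andbF.
have /arrangesU/(_ noncommuting_arranged) :=
  arrangesU dX arrX noninvolutions_arranged.
rewrite !mulg1 => arrG.
have XE : X :|: [set u in G | ~~ P u & u * u != 1] = [set u in G | ~~ P u].
  apply/setP=> u; rewrite !inE; case: (u \in G) => //=.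
  case: (boolP (u * u == 1)) => [/PX->|_]; last by rewrite andbF andbT.
  by rewrite negbK andbT andbF orbF.
have GE : [set u in G | ~~ P u] :|: [set u in G | P u] = G.
  by apply/setP=> u; rewrite !inE; case: (u \in G); case: (P u).
rewrite XE GE in arrG; apply: arrG.
rewrite -setI_eq0; apply/eqP/setP=> u; rewrite !inE.
by case: (P u); rewrite ?andbF.
Qed.

End Involution.

(** * Groups with a noncyclic 2-subgroup *)

(** An abelian [S] contains a Klein four-group, hence commuting involutions [v] and [w]. Otherwise
    choose [y] in the second centre of [S] but outside the centre, and [x] not commuting with [y].
    Then [c] is central, so the commutators of powers of [x] with [y] are powers of [c]. *)
Lemma arranges_noncyclic_2subgroup (gT : finGroupType) (G S : {group gT}) :
  2.-group S -> S \subset G -> ~~ cyclic S -> arranges G 1.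
Proof.
move=> pS /subsetP sSG ncycS; have [abS|nabS] := boolP (abelian S).
  have [E] : exists E, E \in 'E_2^2(S).
    apply/p_rank_geP; rewrite -(rank_pgroup pS) ltnNge.
    by rewrite -abelian_rank1_cyclic.
  move/pnElemPcard=> [/subsetP sES abelE cardE].
  have [cEE expE] := abelemP (isT : prime 2) abelE.
  have {}expE x : x \in E -> x * x = 1 by move=> /expE.
  have [v /setD1P[nt_v Ev]] : exists v, v \in E :\ (1 : gT).
    by apply/set0Pn; rewrite -card_gt0; move: cardE; rewrite (cardsD1 (1 : gT)) group1; case: #|_|.
  have [w] : exists w, w \in E :\ (1 : gT) :\ v.
    apply/set0Pn; rewrite -card_gt0; move: cardE.
    rewrite (cardsD1 (1 : gT)) group1 (cardsD1 v (E :\ (1 : gT))) !inE nt_v Ev.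
    by case: #|_|.
  case/setD1P=> nwv /setD1P[nt_w Ew].
  apply: (@arranges_commuting_involutions _ G v _ nt_v _ w) => //.
  - exact/sSG/sES.
  - exact: expE.
  - exact/sSG/sES.
  - exact: expE.
  - exact: (centsP cEE).
have [yb] : exists2 yb, yb \in 'Z(S / 'Z(S)) & yb != 1.
  apply/trivgPn; rewrite center_nil_eq1 ?quotient_nil ?(pgroup_nil pS) //.
  rewrite -subG1 quotient_sub1 ?gFnorm //.
  by apply: contra nabS => /subset_trans/(_ (subsetIr _ _)).
case/centerP=> /morphimP[y Ny Sy ->{yb}] cy nt_yb.
have nZy : y \notin 'Z(S) by apply: contra nt_yb => Zy; rewrite /= coset_id.
have [x Sx ncxy] : exists2 x, x \in S & x * y != y * x.
  apply/exists_inP; apply: contraR nZy; rewrite negb_exists_in => /forall_inP h.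
  by apply/centerP; split=> // x Sx; apply/esym/eqP; have := h x Sx; rewrite negbK.
have nZ z : z \in S -> z \in 'N('Z(S)) by apply/subsetP: z; apply: gFnorm.
pose c := [~ x, y].
have Sc : c \in S by rewrite groupR.
have /centerP[_ Zc] : c \in 'Z(S).
  apply: coset_idr; first exact: nZ.
  rewrite morphR ?nZ //; apply/eqP/commgP/esym/cy.
  by apply: mem_quotient.
have nt_c : c != 1 by apply: contra ncxy => /commgP/eqP.
have [k ok] := p_natP (mem_p_elt pS Sc).
case: k ok => [|k] ok; first by rewrite -order_eq1 ok in nt_c.
have Zv z : z \in S -> c ^+ (2 ^ k) * z = z * c ^+ (2 ^ k).
  by move=> Sz; apply: esym; exact: (commuteX _ (esym (Zc z Sz))).
(* The exponent is half the order [2 ^ k.+1] of [c], which makes the commutator an involution. *)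
have cE : x ^+ (2 ^ k) * y = c ^+ (2 ^ k) * (y * x ^+ (2 ^ k)).
  rewrite commgC commXg; last exact/esym/Zc.
  by rewrite Zv ?groupM ?groupX.
have ov : #[c ^+ (2 ^ k)] = 2%N.
  by rewrite orderXdiv ok ?dvdn_exp2l // expnS mulnK ?expn_gt0.
apply: (arranges_involution_commutator _ _ _ _ _ _ _ cE).
- by rewrite sSG ?groupX.
- by rewrite -order_eq1 ov.
- by have := expg_order (c ^+ (2 ^ k)); rewrite ov.
- by rewrite sSG ?groupX.
- exact: sSG.
- by rewrite Zv ?groupX.
- exact: Zv.
Qed.

(** * Transfer into a cyclic Sylow 2-subgroup *)

(** Orders are invariant under conjugation, so this form shows that conjugate powers of [g] have
    exponents of the same parity. *)
Lemma odd_expg_order (gT : finGroupType) (g : gT) k :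
  2.-elt g -> g != 1 -> odd k = (#[g ^+ k] == #[g]).
Proof.
move=> pg nt_g.
rewrite orderXgcd eq_sym eqn_div ?gcdn_gt0 ?order_gt0 ?dvdn_gcdl //.
rewrite -{3}[#[g]]muln1 eqn_pmul2l // -[_ == 1%N]/(coprime _ k).
have [[|m] om] := p_natP pg; first by rewrite -order_eq1 om in nt_g.
by rewrite om coprime_pexpl // coprime2n.
Qed.

Lemma natr_Zp_eq n a b :
  (1 < n)%N -> (a%:R == b%:R :> 'Z_n)%R = (a == b %[mod n]).
Proof. by move=> n1; rewrite -val_eqE /= !val_Zp_nat. Qed.

(* Burnside transfer: it maps a generator [g] of the Sylow subgroup to a      *)
(* product of conjugates of the powers [g ^+ n], whose exponents [n] add up   *)
(* to the odd index of [S]; as [S] is a cyclic 2-group, conjugation preserves *)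
(* the parity of the exponents, so that the image of [g] generates [S].       *)
Lemma cyclic_Sylow2_morphism (gT : finGroupType) (G S : {group gT}) :
    2.-Sylow(G) S -> cyclic S -> (1 < #|S|)%N ->
  exists f : gT -> 'Z_#|S|,
    {in G &, {morph f : x y / x * y >-> (x + y)%R}}
    /\ (forall z, exists2 x, x \in G & f x = z).
Proof.
move=> sylS cycS S_gt1; have sSG := pHall_sub sylS.
have [g defS] := cyclicP cycS.
have ntg : g != 1 by rewrite -order_gt1 orderE -defS.
have Sg : g \in S by rewrite defS cycle_id.
have Gg := subsetP sSG g Sg.
have pg := mem_p_elt (pHall_pgroup sylS) Sg.
have abS : abelian (idm S @* S) by rewrite morphim_idm // cyclic_abelian.
pose tau := transfer G abS; pose h x := FiniteModule.fmval (tau x).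
have imS : idm S @* S = S by apply: morphim_idm.
have hS x : h x \in S.
  by have : h x \in idm S @* S := FiniteModule.fmodP _; rewrite imS.
have hM : {in G &, {morph h : x y / x * y}}.
  by move=> x y Gx Gy; rewrite /h /tau transferM.
have hX t : h (g ^+ t) = h g ^+ t.
  elim: t => [|t IHt]; last by rewrite !expgS hM ?groupX ?IHt.
  by apply: (mulgI (h 1)); rewrite -hM ?group1 // !mulg1.
have [K oddK hg] : exists2 K, odd K & h g = g ^+ K.
  have trX := transversalP (rcosets_cycle_partition sSG Gg).
  set X := transversal _ _ in trX.
  have /fin_all_exists[k kP] x : exists k, x \in X ->
      odd k = odd #|<[g]> : S :* x| /\ (g ^+ #|<[g]> : S :* x|) ^ x^-1 = g ^+ k.
    have [Xx|nXx] := boolP (x \in X); last by exists 0%N.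
    have conjS : (g ^+ #|<[g]> : S :* x|) ^ x^-1 \in <[g]>.
      rewrite -{2}defS conjgE invgK mulgA -mem_rcoset.
      exact: mulg_exp_card_rcosets.
    have [k kE] := cycleP _ _ conjS; exists k; split=> //.
    by rewrite !(odd_expg_order _ pg ntg) -kE orderJ.
  exists (\sum_(x in X) k x)%N.
    have oddGS : odd #|G : S|.
      by rewrite odd_2'nat; case/and3P: sylS.
    suff -> : odd (\sum_(x in X) k x) = odd #|G : S| by [].
    rewrite -(sum_index_rcosets_cycle sSG Gg trX).
    elim/big_ind2: _ => // [a b c d ab cd|x /kP[]//].
    by rewrite !oddD ab cd.
  rewrite /h /tau (transfer_cycle_expansion sSG abS Gg trX).
  rewrite FiniteModule.fmval_sum.
  elim/big_rec2: _ => // x a b Xx ->; rewrite expgD /restrm /=; congr (_ * _).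
  rewrite FiniteModule.fmodKcond (kP x Xx).2 ifT //.
  suff: g ^+ k x \in idm S @* S by [].
  by rewrite imS defS mem_cycle.
have gen_hg : <[h g]> = <[g]>.
  have := odd_expg_order K pg ntg; rewrite oddK -hg => /esym/eqP ohg.
  apply/eqP; rewrite eqEcard -!orderE ohg leqnn andbT cycle_subG.
  by have := hS g; rewrite defS.
have n_gt1 : (1 < #[g])%N by rewrite orderE -defS.
have cardS : #|S| = #[g] by rewrite defS.
rewrite cardS.
(* [e x] is a discrete logarithm of [h x] to the base [g], well defined modulo [#[g]]. *)
have /fin_all_exists[e he] x : exists e, h x = g ^+ e.
  by apply/cycleP; rewrite -defS.
exists (fun x => (e x)%:R)%R; split=> [x y Gx Gy|z].
  apply/eqP; rewrite -GRing.natrD natr_Zp_eq // -eq_expg_mod_order.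
  by rewrite expgD -!he hM.
have : g ^+ z \in <[h g]> by rewrite gen_hg mem_cycle.
case/cycleP=> t; rewrite -hX he => /esym/eqP.
rewrite eq_expg_mod_order -natr_Zp_eq // natr_Zp => /eqP <-.
by exists (g ^+ t); rewrite ?groupX.
Qed.

Lemma arranges_or_cyclic_2quotient (gT : finGroupType) (G : {group gT}) :
  arranges G 1 \/
  exists (m : nat) (f : gT -> 'Z_(2 ^ m)),
    [/\ (0 < m)%N, {in G &, {morph f : x y / x * y >-> (x + y)%R}},
        forall z, exists2 x, x \in G & f x = z
      & exists2 d, odd d & #|G| = (2 ^ m * d)%N].
Proof.
have [S sylS] := Sylow_exists 2 G; have sSG := pHall_sub sylS.
have [cycS|] := boolP (cyclic S); last first.
  by left; apply: arranges_noncyclic_2subgroup (pHall_pgroup sylS) _ _.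
have oddGS : odd #|G : S| by rewrite odd_2'nat; case/and3P: sylS.
have [m cardS] := p_natP (pHall_pgroup sylS); rewrite /= in cardS.
case: m cardS => [|m] cardS.
  by left; apply: arranges_odd; rewrite -(Lagrange sSG) cardS mul1n.
right; exists m.+1; have := cyclic_Sylow2_morphism sylS cycS.
rewrite cardS -{1}(expn0 2) ltn_exp2l // => /(_ isT)[f [fM f_surj]].
exists f; split=> //; exists #|G : S| => //.
by rewrite -cardS Lagrange.
Qed.

(** * Words, bracketings and lifts along morphisms *)

(** An associative target does not see the bracketing, only the word of factors. *)
Lemma product_value_morph (Q : finLoopType) (T : Type) (idx : T)
    (op : Monoid.law idx) (f : Q -> T) (t : product_tree Q) :
    {morph f : x y / x * y >-> op x y} ->
  f (product_value t) = \big[op/idx]_(x <- factors t) f x.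
Proof.
move=> fM; elim: t => [x|t IHt u IHu] /=; first by rewrite big_seq1.
by rewrite fM IHt IHu big_cat.
Qed.

Lemma exists_product_tree (T : Type) (s : seq T) :
  (0 < size s)%N -> exists t : product_tree T, factors t = s.
Proof.
case: s => // x s _; elim: s x => [|y s IHs] x; first by exists (Factor x).
by have [t ts] := IHs y; exists (Product (Factor x) t); rewrite /= ts.
Qed.

Lemma perm_eq_map_lift (S T : eqType) (f : S -> T) (s : seq S) (w : seq T) :
  perm_eq w (map f s) -> exists2 s', perm_eq s' s & map f s' = w.
Proof.
case: s => [|x0 s]; first by move/perm_nilP->; exists [::].
case/(perm_iotaP (f x0)) => Is permI ->; exists (map (nth x0 (x0 :: s)) Is).
  by apply/(perm_iotaP x0); exists Is; rewrite // -(size_map f).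
rewrite -map_comp; apply/eq_in_map => i /=.
rewrite (perm_mem permI) mem_iota size_map /= => ltis.
by rewrite -(nth_map x0 (f x0)).
Qed.

Lemma count_flatten_nseq (T : Type) (a : pred T) r (s : seq T) :
  count a (flatten (nseq r s)) = (r * count a s)%N.
Proof. by rewrite count_flatten map_nseq sumn_nseq mulnC. Qed.

Lemma arrangement_power (gT : finGroupType) (G : {group gT}) r :
    (odd r -> arranges G 1) ->
  exists2 w : seq gT, forall g, count_mem g w = (r * (g \in G))%N
                    & \prod_(x <- w) x = 1.
Proof.
have prod_rep k (s : seq gT) : \prod_(x <- s) x = 1 ->
    \prod_(x <- flatten (nseq k s)) x = 1.
  by move=> s1; elim: k => [|k IHk] /=; rewrite ?big_nil // big_cat /= s1 IHk mulg1.
move=> arrG; have [/arrG[s [us sG s1]]|evr] := boolP (odd r).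
  exists (flatten (nseq r s)); last exact: prod_rep.
  by move=> g; rewrite count_flatten_nseq count_uniq_mem // sG.
(* Each element of [G] occurs twice in [s], once as [x] and once as an inverse, so [r./2] copies
   suffice. *)
pose s := flatten [seq [:: x; x^-1] | x <- enum G].
exists (flatten (nseq r./2 s)).
  have cs g : count_mem g s = (g \in G).*2.
    have -> : count_mem g s = (count_mem g (enum G) + count_mem g^-1 (enum G))%N.
      rewrite /s; elim: (enum _) => //= x e ->.
      by rewrite -(inj_eq invg_inj x^-1) invgK [RHS]addnACA addnA.
    by rewrite !count_uniq_mem ?enum_uniq // !mem_enum groupV addnn.
  by move=> g; rewrite count_flatten_nseq cs -doubleMr doubleMl even_halfK.
apply: prod_rep; rewrite /s; elim: (enum _) => [|x e IHe] /=.
  by rewrite big_nil.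
by rewrite !big_cons IHe mulg1 mulgV.
Qed.

(** A word whose letters occur as often as their fibres have elements is a rearrangement of the list
    of values of [f], so it lifts to an ordering of [Q]. *)
Lemma full_product_lift (Q : finLoopType) (gT : finGroupType) (f : Q -> gT)
    (w : seq gT) :
    {morph f : x y / x * y} ->
    (forall g, count_mem g w = #|[set x | f x == g]|) ->
    \prod_(x <- w) x = 1 ->
  exists2 q : Q, full_product q & f q = 1.
Proof.
move=> fM cw w1.
have [|s perm_s sw] := @perm_eq_map_lift _ _ f (enum Q) w.
  apply/allP=> g _ /=; rewrite cw count_map -size_filter cardE.
  apply/eqP/perm_size/uniq_perm => [||x].
  - exact: enum_uniq.
  - exact/filter_uniq/enum_uniq.
  by rewrite [LHS]mem_enum [RHS]mem_filter mem_enum !inE andbT.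
have sE x : count_mem x s = 1%N.
  by rewrite (seq.permP perm_s) count_uniq_mem ?enum_uniq // mem_enum.
have [|t ts] := @exists_product_tree _ s.
  by rewrite lt0n; apply/eqP=> /size0nil s0; have := sE 1; rewrite s0.
exists (product_value t); first by exists t; split=> // x; rewrite ts.
by rewrite (product_value_morph _ fM) ts -[RHS]w1 -sw big_map.
Qed.

Lemma card_fibers (S T : finType) (f : S -> T) (D : {set T}) k :
    (forall x, f x \in D) -> (forall z, z \in D -> #|[set x | f x == z]| = k) ->
  #|S| = (k * #|D|)%N.
Proof.
move=> fD fk; rewrite -[#|S|]sum1_card. rewrite (partition_big f (fun z => z \in D)) //=.
rewrite mulnC -sum_nat_const; apply: eq_bigr => z Dz.
by rewrite -(fk z Dz) -sum1_card; apply: eq_bigl => x; rewrite inE.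
Qed.

Lemma card_loop_coset (Q : finLoopType) (N : {set Q}) (x : Q) :
  #|loop_coset N x| = #|N|.
Proof. by apply: card_imset; apply: ltrans_inj. Qed.

(** * The group Q/A(Q) as a permutation group *)

Section AssociatorQuotient.
Variable Q : finLoopType.

Let A := NormalSubloop (associator_subloop_normal Q).
Let D : finLoopType := quotient_loop A.

(* Right translations, because the product of [{perm D}] is left-to-right     *)
(* composition. The image is the group Q/A(Q) as a [{group _}].               *)
Definition associator_rep (x : Q) : {perm D} :=
  perm (@rtrans_inj D (to_quotient A x)).

Lemma associator_repM : {morph associator_rep : x y / x * y}.
Proof.
move=> x y; apply/permP=> z; rewrite permM !permE /rtrans to_quotientM.
have /forallP/(_ z)/forallP/(_ (to_quotient A x))/forallP/(_ (to_quotient A y)) :=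
  associator_subloop_quotient Q.
by move/eqP.
Qed.

(** A right translation is determined by its value at 1, which here is the coset. *)
Lemma associator_rep_eq x y :
  (associator_rep x == associator_rep y) = (x \in loop_coset (associator_subloop Q) y).
Proof.
apply/eqP/(coset_eqP A) => [/permP/(_ 1)|eqc]; first last.
  by apply/permP=> z; rewrite !permE /rtrans; congr (_ * _); apply: val_inj.
by rewrite !permE /rtrans !mul1g => /(congr1 val).
Qed.

Lemma card_associator_rep_fiber x :
  #|[set y | associator_rep y == associator_rep x]| = #|associator_subloop Q|.
Proof.
rewrite -(card_loop_coset (associator_subloop Q) x); apply: eq_card => y.
by rewrite inE associator_rep_eq.
Qed.

Lemma associator_rep1 : associator_rep 1 = 1.
Proof. by apply: (mulgI (associator_rep 1)); rewrite -associator_repM !mulg1. Qed.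

Lemma associator_rep_group_set : group_set (associator_rep @: Q).
Proof.
apply/group_setP; split.
  by apply/imsetP; exists 1; rewrite ?associator_rep1.
move=> _ _ /imsetP[x _ ->] /imsetP[y _ ->].
by rewrite -associator_repM imset_f.
Qed.
Canonical associator_rep_group := Group associator_rep_group_set.

Lemma card_associator_rep :
  #|Q| = (#|associator_subloop Q| * #|associator_rep @: Q|)%N.
Proof.
apply: (card_fibers (f := associator_rep)) => [x|_ /imsetP[x _ ->]].
  exact: imset_f.
exact: card_associator_rep_fiber.
Qed.

End AssociatorQuotient.

(** * Morphisms to cyclic groups and their kernels *)

Section CyclicQuotient.
Variables (Q : finLoopType) (n : nat).
Hypothesis n_gt1 : (1 < n)%N.

Section Kernel.
Variable f : Q -> 'Z_n.
Hypothesis fM : {morph f : x y / x * y >-> (x + y)%R}.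

Definition loop_kernel : {set Q} := [set x | f x == 0%R].

Let f1 : f 1 = 0%R.
Proof. by apply: (GRing.addIr (f 1)); rewrite -fM mulg1 GRing.add0r. Qed.

Let f_ldiv x z : f (finv (ltrans x) z) = (f z - f x)%R.
Proof.
rewrite -{2}(f_finv (@ltrans_inj _ x) z) {2}/ltrans fM.
by rewrite GRing.addrC GRing.addrA GRing.addNr GRing.add0r.
Qed.

Let f_rdiv x z : f (finv (rtrans x) z) = (f z - f x)%R.
Proof. by rewrite -{2}(f_finv (@rtrans_inj _ x) z) {2}/rtrans fM GRing.addrK. Qed.

Lemma loop_kernel_coset x y : (x \in loop_coset loop_kernel y) = (f x == f y).
Proof.
apply/imsetP/eqP => [[z] | fxy].
  by rewrite inE => /eqP fz ->; rewrite fM fz GRing.addr0.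
exists (finv (ltrans y) x); last by rewrite f_finv //; apply: ltrans_inj.
by rewrite inE f_ldiv fxy GRing.subrr.
Qed.

(** The target is associative and commutative, so every inner mapping preserves the values of [f],
    and in particular the zero fibre. *)
Lemma loop_kernel_normal : normal_subloop loop_kernel.
Proof.
have inv (g : Q -> Q) : injective g -> (forall x, f (g x) = f x) ->
    g @: loop_kernel == loop_kernel.
  by move=> ginj fg; apply: sub_invariant_eq => // x; rewrite !inE fg.
apply/and4P; split.
- apply/and4P; split; first by rewrite inE f1.
  + apply/forall_inP=> x; rewrite inE => /eqP fx; apply/forall_inP=> y.
    by rewrite !inE fM fx => /eqP->; rewrite GRing.addr0.
  + apply/forall_inP=> x; rewrite inE => /eqP fx; apply/forall_inP=> y.
    by rewrite !inE f_ldiv fx => /eqP->; rewrite GRing.subrr.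
  + apply/forall_inP=> x; rewrite inE => /eqP fx; apply/forall_inP=> y.
    by rewrite !inE f_rdiv fx => /eqP->; rewrite GRing.subrr.
- apply/forallP=> x; apply/forallP=> y; apply: inv.
    do 2![apply: inj_comp; last exact: ltrans_inj].
    by apply: finv_inj; apply: ltrans_inj.
  move=> z; rewrite /= f_ldiv !fM GRing.addrA.
  by rewrite [X in (X - _)%R]GRing.addrC GRing.addrK.
- apply/forallP=> x; apply/forallP=> y; apply: inv.
    do 2![apply: inj_comp; last exact: rtrans_inj].
    by apply: finv_inj; apply: rtrans_inj.
  by move=> z; rewrite /= f_rdiv !fM -[X in (X - _)%R]GRing.addrA GRing.addrK.
apply/forallP=> x; apply: inv.
  by apply: inj_comp; [apply: finv_inj; apply: rtrans_inj|apply: ltrans_inj].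
by move=> z; rewrite /= f_rdiv !fM GRing.addrC GRing.addKr.
Qed.

Hypothesis f_surj : forall z, exists x, f x = z.

Lemma loop_kernel_isom :
  isom_Zn (quotient_loop (NormalSubloop loop_kernel_normal)) n.
Proof.
set N := NormalSubloop _.
(* [r] chooses coset representatives and [s] below is a section of [f]; the isomorphism is [f \o r],
   with inverse induced by [s]. *)
have /fin_all_exists[r rK] := @to_quotientP Q N.
have eqN x y : (to_quotient N x = to_quotient N y) <-> f x = f y.
  split=> [/(congr1 val)/(coset_eqP N)|fxy].
    by rewrite loop_kernel_coset => /eqP.
  by apply/val_inj/(coset_eqP N); rewrite loop_kernel_coset fxy.
have fr x : f (r (to_quotient N x)) = f x by apply/eqN; rewrite -rK.
have /fin_all_exists[s sK] := f_surj.
exists (f \o r); split.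
  exists (fun z => to_quotient N (s z)) => [a|z] /=; last by rewrite fr sK.
  by rewrite {2}(rK a); apply/eqN; rewrite sK.
by move=> a b /=; rewrite {1}(rK a) {1}(rK b) -to_quotientM fr fM.
Qed.

Lemma card_loop_kernel : #|Q| = (#|loop_kernel| * n)%N.
Proof.
have cZ : #|[set: 'Z_n]| = n by rewrite cardsT card_ord Zp_cast.
rewrite -[X in (_ * X)%N]cZ; apply: (card_fibers (f := f)) => [x|z _]; first by rewrite inE.
have [y <-] := f_surj z; rewrite -(card_loop_coset loop_kernel y).
by apply: eq_card => x; rewrite loop_kernel_coset inE.
Qed.

End Kernel.
End CyclicQuotient.

(** The quotient is a group, so [N] contains A(Q) and the composite with the projection vanishes
    there; its fibres are the cosets of [N]. *)
Lemma isom_Zn_morphism (Q : finLoopType) (N : normalSubloop Q) n :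
    isom_Zn (quotient_loop N) n ->
  exists f : Q -> 'Z_n,
    [/\ {morph f : x y / x * y >-> (x + y)%R},
        {in associator_subloop Q, forall x, f x = 0%R}
      & forall z, #|[set x | f x == z]| = #|N|].
Proof.
case=> F [bijF FM]; have [F' FK F'K] := bijF.
have fM : {morph (F \o to_quotient N) : x y / x * y >-> (x + y)%R}.
  by move=> x y; rewrite /= to_quotientM FM.
have gN : is_group (quotient_loop N).
  apply/forallP=> a; apply/forallP=> b; apply/forallP=> c.
  by rewrite -(inj_eq (bij_inj bijF)) !FM GRing.addrA.
have f1 : F (to_quotient N 1) = 0%R.
  by apply: (GRing.addIr (F (to_quotient N 1))); rewrite -FM mulg1 GRing.add0r.
exists (F \o to_quotient N); split=> // [x Ax|z] /=.
  have Nx := subsetP (associator_subloop_min gN) x Ax.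
  rewrite -[RHS]f1; congr F; apply/val_inj; rewrite /= !coset1_id ?nsub1 //.
have [y yE] := to_quotientP (F' z); rewrite -(card_loop_coset N y).
apply: eq_card => x; rewrite inE -[z]F'K (inj_eq (bij_inj bijF)) yE.
by apply/eqP/(coset_eqP N) => [/(congr1 val)//|e]; apply: val_inj.
Qed.

(** * Sums over a loop with values in a cyclic group *)

(** Each residue contributes [k] times, and 0 + 1 + ... + (n - 1) is the binomial coefficient. *)
Lemma sum_fibers_Zn (T : finType) (n k : nat) (f : T -> 'Z_n) :
    (1 < n)%N -> (forall z, #|[set x | f x == z]| = k) ->
  (\sum_x f x = (k * 'C(n, 2))%:R)%R.
Proof.
move=> n_gt1 fk; rewrite (partition_big f xpredT) //=.
transitivity (\sum_(z : 'Z_n) z *+ k)%R.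
  apply: eq_bigr => z _; rewrite -(fk z) -GRing.sumr_const.
  by apply: eq_big => [x|x /eqP//]; rewrite inE.
rewrite GRing.sumrMnl mulnC GRing.natrM -[LHS]GRing.mulr_natr; congr (_ * _)%R.
have -> : 'C(n, 2) = (\sum_(z : 'Z_n) z)%N.
  transitivity 'C((Zp_trunc n).+2, 2); first by rewrite Zp_cast.
  by rewrite -triangular_sum big_mkord.
by rewrite GRing.natr_sum; apply: eq_bigr => z _; rewrite natr_Zp.
Qed.

(** With n = 2^m, doubling [k * 'C(n, 2)] gives [n * (k * n.-1)], where [k * n.-1] is odd; hence 2n
    does not divide the double, nor n the original. *)
Lemma sum_Z2m_neq0 (m k : nat) :
  (0 < m)%N -> odd k -> ((k * 'C(2 ^ m, 2))%:R != 0 :> 'Z_(2 ^ m))%R.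
Proof.
move=> m_gt0 oddk; have : (1 < 2 ^ m)%N by rewrite -{1}(expn0 2) ltn_exp2l.
have : ~~ odd (2 ^ m) by rewrite oddX negb_or -lt0n m_gt0.
move: (2 ^ m)%N => n evn n_gt1; have n_gt0 := ltnW n_gt1.
rewrite -[0%R]/(0%:R)%R natr_Zp_eq // mod0n; apply/negP => dv.
have : (n * 2 %| k * 'C(n, 2) * 2)%N by rewrite dvdn_pmul2r.
have -> : (k * 'C(n, 2) * 2 = n * (k * n.-1))%N.
  by rewrite -mulnA bin2 muln2 even_halfK 1?mulnCA // oddM negb_and evn.
rewrite dvdn_pmul2l // dvdn2 oddM oddk /= -subn1 oddB //.
by rewrite (negPf evn).
Qed.

(** * The implications between the three conditions *)

Lemma full_product_conditionB (Q : finLoopType) : conditionC Q -> conditionB Q.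
Proof.
case=> q [Aq [t [ct tq]]] [N [m [oddN m_gt0 isoN]]].
have n_gt1 : (1 < 2 ^ m)%N by rewrite -{1}(expn0 2) ltn_exp2l.
have [f [fM fA cf]] := isom_Zn_morphism isoN.
have /eqP[] := sum_Z2m_neq0 m_gt0 oddN.
rewrite -(sum_fibers_Zn n_gt1 cf); apply: etrans (fA q Aq).
rewrite -tq (product_value_morph _ fM) /=; symmetry.
apply: perm_big; apply/allP => x _ /=.
by rewrite ct count_uniq_mem ?index_enum_uniq // mem_index_enum.
Qed.

(** Let s be the sum of [f] over [Q]. Rows, columns and entries of a transversal each run once
    through [Q], so summing [f (x * y) = f x + f y] over it gives s = s + s. *)
Lemma transversal_conditionB (Q : finLoopType) : conditionA Q -> conditionB Q.
Proof.
case=> S [/subsetP sS S1 S2 S3] [N [m [oddN m_gt0 isoN]]].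
have n_gt1 : (1 < 2 ^ m)%N by rewrite -{1}(expn0 2) ltn_exp2l.
have [f [fM _ cf]] := isom_Zn_morphism isoN.
have /eqP[] := sum_Z2m_neq0 m_gt0 oddN.
rewrite -(sum_fibers_Zn n_gt1 cf).
have sumS (g : Q * Q * Q -> Q) : (forall x, #|[set t in S | g t == x]| = 1%N) ->
    (\sum_(t in S) f (g t) = \sum_x f x)%R.
  move=> g1; rewrite (partition_big g xpredT) //=; apply: eq_bigr => x _.
  transitivity (f x *+ #|[set t in S | g t == x]|)%R; last by rewrite g1.
  rewrite -GRing.sumr_const.
  by apply: eq_big => [t|t /andP[_ /eqP->]//]; rewrite inE.
apply: (GRing.addrI (\sum_x f x)%R); rewrite GRing.addr0.
rewrite -{1}(sumS _ S1) -{1}(sumS _ S2) -(sumS _ S3) -big_split /=.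
by apply: eq_bigr => t /sS/imset2P[x y _ _ ->]; rewrite fM.
Qed.

Lemma conditionB_full_product (Q : finLoopType) : conditionB Q -> conditionC Q.
Proof.
move=> condB; set G := associator_rep_group Q.
have arrG : odd #|associator_subloop Q| -> arranges G 1.
  move=> oddA; have [//|[m [f [m_gt0 fM f_surj [d oddd cardG]]]]] :=
    arranges_or_cyclic_2quotient G.
  have n_gt1 : (1 < 2 ^ m)%N by rewrite -{1}(expn0 2) ltn_exp2l.
  pose h (x : Q) := f (associator_rep x).
  have hM : {morph h : x y / x * y >-> (x + y)%R}.
    by move=> x y; rewrite /h associator_repM fM ?imset_f.
  have h_surj z : exists x, h x = z.
    by have [_ /imsetP[x _ ->] fx] := f_surj z; exists x.
  case: condB; exists (NormalSubloop (loop_kernel_normal hM)), m; split=> //.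
    (* Cancelling [2 ^ m] shows that the kernel of [h] has order |A(Q)| [d], a product of odd
       numbers. *)
    have := card_associator_rep Q; rewrite (card_loop_kernel n_gt1 hM h_surj).
    have -> : #|@associator_rep Q @: Q| = (2 ^ m * d)%N := cardG.
    rewrite mulnCA mulnC => /eqP.
    by rewrite eqn_pmul2l ?expn_gt0 // => /eqP ->; rewrite oddM oddA.
  exact: loop_kernel_isom.
(* The multiplicity is |A(Q)|, the size of the fibres of [associator_rep]. *)
have [w cw w1] := arrangement_power arrG.
have [|q Pq q1] := full_product_lift (@associator_repM Q) _ w1.
  move=> g; rewrite cw; have [/imsetP[x _ ->]|nGg] := boolP (g \in G).
    by rewrite card_associator_rep_fiber muln1.
  rewrite muln0; apply/esym/eqP; rewrite cards_eq0; apply/eqP/setP=> x.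
  by rewrite !inE; apply: contraNF nGg => /eqP <-; apply: imset_f.
exists q; split=> //; have := associator_rep_eq q 1.
pose A := NormalSubloop (associator_subloop_normal Q).
by rewrite associator_rep1 q1 eqxx (@coset1_id _ A) ?nsub1.
Qed.

Theorem mainTheorem4 (Q : finLoopType) :
  (conditionA Q -> conditionC Q) /\ (conditionB Q <-> conditionC Q).
Proof.
split; last by split; [apply: conditionB_full_product|apply: full_product_conditionB].
by move=> /transversal_conditionB/conditionB_full_product.
Qed.
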